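(* Let $$\Omega(x)=\begin{cases}[I,J;K](x)&\text{if }x\geqslant p\\ [I',J';K'](x)&\text{if }x<p\end{cases}$$ be a pseudotriad at an X-point $p$. Then $\Omega$ determines a projective collineation $\lambda$ of $\mathbb{P}^2(\mathbb{Q})$ which maps the unprimed components (the lines $I,J,K$) to the corresponding primed ones (the lines $I',J',K'$) and fixes $o_\infty$. Such a collineation, which is a homology if and only if the X-point $p$ is regular, induces a self-equivalence $\Omega\sim\Omega$, that is, $f(\Omega(x))=\Omega(\mu(x))$ near $p$, via the pair $(\mu,f)$ given by $$\mu=\left(\frac{K'-I'}{K'-J'}\right)^{-1}\circ\frac{K-I}{K-J}$$ (inverse as a M\''obius transformation) and $$f(z)=\frac{K'(\mu(x))-I'(\mu(x))}{K(x)-I(x)}\,z+\frac{K(x)\cdot I'(\mu(x))-I(x)\cdot K'(\mu(x))}{K(x)-I(x)}.$$ This (non-trivial, local) self-equivalence is unique up to inversion. The inverse of $\mu$ and the corresponding $f$ are obtained by interchanging all primed and unprimed quantities.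
   Context: $I,J,K,I',J',K'$ are affine functions of one real variable with rational coefficients; the same symbols denote their graphs (lines). The point $(x,y)\in\mathbb{Q}^2$ is identified with $(x,y,1)\in\mathbb{P}^2(\mathbb{Q})$ and $o_\infty=(0,1,0)$ is the point at infinity of the vertical direction. The symbol $p$ denotes both a point of the plane and its abscissa. A pseudotriad at $p$ is given by such data with: $I,J,I',J'$ concurrent at $p$; the point $p$ not on $K$ or $K'$; the lines $K$ and $K'$ do not meet on the vertical line $po_\infty$; and, near $p$, either ($J<I<K$ for $x>p$ and $K'<I'<J'$ for $x<p$) or the same with primed and unprimed functions exchanged ($K<I<J$ for $x>p$ and $J'<I'<K'$ for $x<p$). The functions $I,J$ (for $x\geqslant p$) and $I',J'$ (for $x<p$) are the branches of the two functions whose transversal intersection is the X-point $p$. The X-point is regular when these two functions are affine at $p$, i.e. $I=I'$ and $J=J'$. A homology is a projective collineation with a line of fixed points (the axis) and an additional fixed point (the centre) not on the axis. A local self-equivalence via $(\mu,f)$ means $f(\Omega(x))=\Omega(\mu(x))$ (equality of multisets of values, $f$ acting elementwise) for $x$ sufficiently close to $p$, where $\mu$ is a M\''obius transformation with rational coefficients and $f(z)=A(x)z+B(x)$ with $A,B\in\mathbb{Q}(x)$. The displayed pair is applied on the right of $p$ ($\mu$ carries a right neighbourhood of $p$ to a left one, and $f(I(x))=I'(\mu(x))$, etc.); on the left of $p$ one uses the inverse pair, obtained by interchanging primed and unprimed quantities. *)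

(* Defs.v *)
From HB Require Import structures.
From mathcomp Require Import all_boot all_order all_algebra fraction.
From mathcomp Require Import all_classical all_reals all_analysis.
Set Implicit Arguments.
Unset Strict Implicit.
Unset Printing Implicit Defensive.
Import Order.TTheory GRing.Theory Num.Theory.
Import numFieldNormedType.Exports.
Local Open Scope classical_set_scope.
Local Open Scope ring_scope.

Record affine := Affine { slope : rat; icept : rat }.

(* The variable ranges over an arbitrary real field R, which covers both the
   real line and the rational line. *)
Definition aeval (R : realFieldType) (L : affine) (x : R) : R :=
  ratr (slope L) * x + ratr (icept L).

(* The components [I, J; K] of a pseudotriad on one side of the X-point. *)
Record triad := Triad { tI : affine; tJ : affine; tK : affine }.

Definition values (R : realFieldType) (W : triad) (x : R) : seq R :=
  [:: aeval (tI W) x; aeval (tJ W) x; aeval (tK W) x].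

(* The sequence is used as a multiset: it is only compared up to perm_eq. *)
Definition Omega (R : realFieldType) (p : rat) (W W' : triad) (x : R) : seq R :=
  if ratr p <= x then values W x else values W' x.

(* J < I < K on the right of p and K' < I' < J' on the left of p. *)
Definition ordered (R : realFieldType) (p : rat) (W W' : triad) : Prop :=
  (\forall x \near (ratr p : R)^'+,
      aeval (tJ W) x < aeval (tI W) x < aeval (tK W) x) /\
  (\forall x \near (ratr p : R)^'-,
      aeval (tK W') x < aeval (tI W') x < aeval (tJ W') x).

Definition ordered_swap (R : realFieldType) (p : rat) (W W' : triad) : Prop :=
  (\forall x \near (ratr p : R)^'+,
      aeval (tK W) x < aeval (tI W) x < aeval (tJ W) x) /\
  (\forall x \near (ratr p : R)^'-,
      aeval (tJ W') x < aeval (tI W') x < aeval (tK W') x).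

(* A graph meets the vertical line through p only at its point of abscissa p,
   so K and K' meet on that line exactly when they agree at p. *)
Definition pseudotriad (R : realFieldType) (p : rat) (W W' : triad) : Prop :=
  [/\ [/\ aeval (tJ W) p = aeval (tI W) p,
          aeval (tI W') p = aeval (tI W) p &
          aeval (tJ W') p = aeval (tI W) p],
      aeval (tK W) p != aeval (tI W) p,
      aeval (tK W') p != aeval (tI W) p,
      aeval (tK W) p != aeval (tK W') p &
      ordered R p W W' \/ ordered_swap R p W W'].

Definition regular (W W' : triad) : Prop := tI W = tI W' /\ tJ W = tJ W'.

(* Points of P^2(Q) are nonzero row vectors up to proportionality; lines are
   nonzero column vectors of coefficients; an invertible matrix L is the
   projective collineation v |-> v *m L. *)
Definition row3 (a b c : rat) : 'rV[rat]_3 := \row_(i < 3) [:: a; b; c]`_i.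

Definition col3 (a b c : rat) : 'cV[rat]_3 := \col_(i < 3) [:: a; b; c]`_i.

Definition pt (x y : rat) : 'rV[rat]_3 := row3 x y 1.

Definition o_infty : 'rV[rat]_3 := row3 0 1 0.

Definition line_of (L : affine) : 'cV[rat]_3 := col3 (slope L) (-1) (icept L).

Definition on (v : 'rV[rat]_3) (l : 'cV[rat]_3) : Prop := v *m l = 0.

Definition same_pt (v w : 'rV[rat]_3) : Prop := (v == w)%MS.

Definition collineation (L : 'M[rat]_3) : Prop := L \in unitmx.

Definition fixes (L : 'M[rat]_3) (v : 'rV[rat]_3) : Prop := same_pt (v *m L) v.

Definition maps_line (L : 'M[rat]_3) (l l' : 'cV[rat]_3) : Prop :=
  forall v : 'rV[rat]_3, v != 0 -> (on v l <-> on (v *m L) l').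

Definition homology (L : 'M[rat]_3) : Prop :=
  collineation L /\
  exists (axis : 'cV[rat]_3) (c : 'rV[rat]_3),
    [/\ axis != 0, c != 0, ~ on c axis, fixes L c &
        forall v, v != 0 -> on v axis -> fixes L v].

Definition triad_collineation (W W' : triad) (L : 'M[rat]_3) : Prop :=
  [/\ collineation L,
      maps_line L (line_of (tI W)) (line_of (tI W')),
      maps_line L (line_of (tJ W)) (line_of (tJ W')),
      maps_line L (line_of (tK W)) (line_of (tK W')) &
      fixes L o_infty].

(* The field Q(x). *)
Notation ratfun := {fraction {poly rat}}.

Definition pfrac (q : {poly rat}) : ratfun := tofrac q.

(* F is defined at x, with value y; F need not be given in lowest terms. *)
Definition ratval (R : realFieldType) (F : ratfun) (x y : R) : Prop :=
  exists n d : {poly rat},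
    [/\ F = pfrac n / pfrac d, (map_poly ratr d).[x] != 0 &
        y = (map_poly ratr n).[x] / (map_poly ratr d).[x]].

(* The composite of an affine function with a rational function. *)
Definition acomp (L : affine) (F : ratfun) : ratfun :=
  pfrac (slope L)%:P * F + pfrac (icept L)%:P.

(* A Moebius transformation (a x + b) / (c x + d) is given by an invertible
   matrix with rows (a, b) and (c, d): composition is *m, inverse is invmx. *)
Definition mobius (M : 'M[rat]_2) : ratfun :=
  pfrac (M 0 0 *: 'X + (M 0 1)%:P) / pfrac (M 1 0 *: 'X + (M 1 1)%:P).

(* The Moebius transformation (K - I) / (K - J). *)
Definition quot_mx (W : triad) : 'M[rat]_2 :=
  \matrix_(i, j) let L := if i == 0 then tI W else tJ W in
    if j == 0 then slope (tK W) - slope L else icept (tK W) - icept L.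

(* The pair (mu, f), with f(z) = A(x) z + B(x). *)
Record transf := Transf { tmu : 'M[rat]_2; tA : ratfun; tB : ratfun }.

Definition same_transf (T T' : transf) : Prop :=
  [/\ mobius (tmu T) = mobius (tmu T'), tA T = tA T' & tB T = tB T'].

Definition trivial_transf (T : transf) : Prop :=
  same_transf T (Transf 1%:M 1 0).

(* mu sends x to m, and the affine map f attached to x is z |-> a z + b. *)
Definition transf_at (R : realFieldType) (T : transf) (x m a b : R) : Prop :=
  [/\ ratval (mobius (tmu T)) x m, ratval (tA T) x a & ratval (tB T) x b].

Definition inverse_transf (R : realFieldType) (T T' : transf) : Prop :=
  mobius (tmu T') = mobius (invmx (tmu T)) /\
  forall x m a b x' a' b' : R,
    transf_at T x m a b -> transf_at T' m x' a' b' ->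
    x' = x /\ forall z, a' * (a * z + b) + b' = z.

Definition triad_transf (W W' : triad) : transf :=
  let M := invmx (quot_mx W') *m quot_mx W in
  let X := pfrac 'X in
  let mu := mobius M in
  Transf M
    ((acomp (tK W') mu - acomp (tI W') mu) / (acomp (tK W) X - acomp (tI W) X))
    ((acomp (tK W) X * acomp (tI W') mu - acomp (tI W) X * acomp (tK W') mu)
       / (acomp (tK W) X - acomp (tI W) X)).

(* F is p^'+ or p^'-: the identity f(Omega(x)) = Omega(mu(x)) is required on one
   side of p.  At p itself it may fail, because K(p) and K'(p) differ; it is a
   relation between germs at p, whence mu(p) = p. *)
Definition local_self_equiv (R : realFieldType) (F : set_system R) (p : rat)
    (W W' : triad) (T : transf) : Prop :=
  [/\ tmu T \in unitmx,
      ratval (mobius (tmu T)) (ratr p : R) (ratr p) &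
      \forall x \near F, exists m a b : R,
        transf_at T x m a b /\
        perm_eq [seq a * z + b | z <- Omega p W W' x] (Omega p W W' m)].

Definition matches_components (R : realFieldType) (F : set_system R)
    (side : R -> Prop) (W W' : triad) (T : transf) : Prop :=
  \forall x \near F, exists m a b : R,
    [/\ transf_at T x m a b, side m,
        a * aeval (tI W) x + b = aeval (tI W') m,
        a * aeval (tJ W) x + b = aeval (tJ W') m &
        a * aeval (tK W) x + b = aeval (tK W') m].

(* The collineation L is (x, y) |-> (mu(x), f(y)). *)
Definition induces (L : 'M[rat]_3) (T : transf) : Prop :=
  forall x y m a b : rat, transf_at T x m a b ->
    same_pt (pt x y *m L) (pt m (a * y + b)).

(* Main.v *)
Require Import Defs.
From HB Require Import structures.
From mathcomp Require Import all_boot all_order all_algebra fraction.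
From mathcomp Require Import all_classical all_reals all_analysis.
From mathcomp Require Import ring lra.
Import Order.TTheory GRing.Theory Num.Theory.
Import numFieldNormedType.Exports.
Local Open Scope classical_set_scope.
Local Open Scope ring_scope.
Set Implicit Arguments.
Unset Strict Implicit.
Unset Printing Implicit Defensive.

(** Why the theorem holds.

    The collineation.  Let N and N' be the matrices whose columns are the
    lines of the two triads.  A linear map L takes the unprimed lines to the
    primed ones when each product of L with a primed column is a multiple of
    the unprimed column, and since every line of a graph takes the same value
    -1 on the coordinates (0, 1, 0) of the vertical point at infinity, fixing
    that point forces the three multiples to be equal.  Hence L is
    proportional to N (N')^-1, and this matrix does the job.

    The transformation.  At a value x with image m, the transformation
    z |-> a z + b of the statement is characterised by three linear equations:
    it takes I(x), J(x), K(x) to I'(m), J'(m), K'(m) ([matching]).  Eliminating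
    b leaves a * Q (x, 1) = Q' (m, 1), with Q and Q' the matrices of (K-I)/(K-J)
    and (K'-I')/(K'-J'); thus (m, 1) = a * (Q'^-1 Q) (x, 1), which is to say that
    m = mu(x) and that a is the inverse of the denominator of mu at x.  So the
    triples (m, a, b) attached to x by the formulas are exactly the solutions
    of the matching equations ([transf_atP]).  Composition, inversion, the
    action of the collineation and the self-equivalence are all read off
    these equations.

    The local picture.  The order conditions say that slope(I) - slope(J) has
    the same sign on both sides, while K - I changes sign between the two sides
    of p.  Hence det Q and det Q' have opposite signs, mu is decreasing at its
    fixed point p, and it exchanges the two sides ([mobius_side]).  The matrix
    L multiplies the coordinates of the X-point by the negative number
    r = (K(p)-I(p)) / (K'(p)-I'(p)) and fixes those of the point at infinity; a
    homology with these two eigenvectors is the identity plus a matrix of rank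
    one whose image is the X-point, so the lines through the X-point are fixed
    and the X-point is regular.  Conversely, when I = I' and J = J', the
    vertical line through the intersection of K and K' is fixed pointwise.

    Uniqueness.  Close to p the value of I lies strictly between those of J
    and K, and the gap between I and J is smaller than the gap between I and K.
    An affine map of the line preserves the middle point and the order of the
    two gaps, so a self-equivalence must match the components one by one
    ([separated_affine]).  If its Moebius transformation preserves the sides of
    p, the matching equations from the triad to itself make it trivial;
    otherwise they make it equal to the transformation of the statement near
    p, hence everywhere, because rational functions that agree on a punctured
    one-sided neighbourhood are equal ([ratfun_ext]). *)

(** * Values of rational functions *)

Lemma ratr_ratE (x : rat) : ratr x = x.
Proof. by rewrite /ratr divq_num_den. Qed.

Lemma aeval_ratr (R : realFieldType) (L : affine) (x : rat) :
  aeval L (ratr x : R) = ratr (aeval L x).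
Proof. by rewrite /aeval !ratr_ratE rmorphD rmorphM. Qed.

Lemma pfrac_eq0 (n : {poly rat}) : (pfrac n == 0) = (n == 0).
Proof. exact: tofrac_eq0. Qed.

Lemma pfracD (n d : {poly rat}) : pfrac (n + d) = pfrac n + pfrac d.
Proof. exact: tofracD. Qed.

Lemma pfracM (n d : {poly rat}) : pfrac (n * d) = pfrac n * pfrac d.
Proof. exact: tofracM. Qed.

Definition affpoly (u v : rat) : {poly rat} := u *: 'X + v%:P.

Lemma affpoly_eval (R : realFieldType) (u v : rat) (x : R) :
  (map_poly ratr (affpoly u v)).[x] = ratr u * x + ratr v.
Proof.
by rewrite /affpoly rmorphD /= map_polyZ map_polyX map_polyC !hornerE.
Qed.

Lemma affpoly_eq0 (u v : rat) : (affpoly u v == 0) = (u == 0) && (v == 0).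
Proof.
apply/eqP/andP => [uv0|[/eqP-> /eqP->]]; last by rewrite /affpoly scale0r add0r.
have := congr1 (fun q : {poly rat} => q`_0) uv0.
have := congr1 (fun q : {poly rat} => q`_1) uv0.
by rewrite /affpoly !coefE /= !(mulr1, mulr0, addr0, add0r) => -> ->.
Qed.

(** A value of a rational function is computed on some representation with a
    nonzero denominator; clearing denominators makes the information available
    on every representation, whose own denominator may vanish at [x]. *)
Lemma ratval_frac (R : realFieldType) (n d : {poly rat}) (x y : R) :
    d != 0 -> ratval (pfrac n / pfrac d) x y ->
  (map_poly ratr n).[x] = y * (map_poly ratr d).[x].
Proof.
move=> d0 [n1 [d1 [eqF d1x ->]]].
have d1_0 : d1 != 0 by apply: contraNneq d1x => ->; rewrite rmorph0 horner0.
move/eqP: eqF; rewrite eqr_div ?pfrac_eq0 // -!pfracM => /eqP.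
move/eqP; rewrite tofrac_eq => /eqP /(congr1 (fun q => (map_poly ratr q).[x])).
rewrite !rmorphM !hornerM => e; apply: (mulIf d1x).
by rewrite e mulrAC divfK.
Qed.

Lemma ratval_uniq (R : realFieldType) (F : ratfun) (x y z : R) :
  ratval F x y -> ratval F x z -> y = z.
Proof.
move=> [n [d [-> dx ->]]] /ratval_frac-> ; last first.
  by apply: contraNneq dx => ->; rewrite rmorph0 horner0.
by rewrite mulfK.
Qed.

(** Dividing out the factor vanishing at [x0] leaves a polynomial which is
    nonzero at [x0], hence around it by continuity. *)
Lemma near_horner_neq0 (R : realFieldType) (x0 : R) (q : {poly R}) :
  q != 0 -> \forall x \near x0^', q.[x] != 0.
Proof.
move=> q0; have [k [g]] := multiplicity_XsubC q x0.
rewrite q0 /= => g0 ->.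
have cg : horner g x @[x --> x0^'] --> g.[x0].
  by move=> A /continuous_horner; exact: nbhs_dnbhs.
near=> x; rewrite hornerM mulf_neq0 //.
  by near: x; apply: cvgr_neq0 cg _; rewrite -rootE.
rewrite horner_exp expf_neq0 // hornerXsubC subr_eq0.
by near: x; exact: nbhs_dnbhs_neq.
Unshelve. all: by end_near. Qed.

(** Cross-multiplying turns the agreement into the vanishing of a polynomial
    on a set of the filter [F], which a nonzero polynomial avoids near [x0].
    Only a punctured neighbourhood is required, so that the field may be
    non-archimedean and the filter one-sided. *)
Lemma ratfun_ext (R : realFieldType) (x0 : R) (F : set_system R)
    {FF : ProperFilter F} (f g : ratfun) : F `=>` x0^' ->
    (\forall x \near F, exists2 y, ratval f x y & ratval g x y) -> f = g.
Proof.
move=> Fx0 fg.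
(* A single common point provides denominators. *)
have /filter_ex [x [y fxy gxy]] := fg.
case: fxy => n [d [ef dx _]]; case: gxy => n' [d' [eg d'x _]].
have d0 : d != 0 by apply: contraNneq dx => ->; rewrite rmorph0 horner0.
have d'0 : d' != 0 by apply: contraNneq d'x => ->; rewrite rmorph0 horner0.
rewrite {}ef {}eg in fg *; apply/eqP.
rewrite eqr_div ?pfrac_eq0 // -!pfracM tofrac_eq -subr_eq0.
apply: contraT => q0.
have /near_horner_neq0 : map_poly ratr (n * d' - n' * d) != 0 :> {poly R}.
  by rewrite map_poly_eq0.
move=> /(_ x0)/Fx0 qN0.
have [z [[t fz gz] /eqP[]]] := filter_ex (filterI fg qN0).
rewrite rmorphB !rmorphM hornerD hornerN !hornerM.
by rewrite (ratval_frac d0 fz) (ratval_frac d'0 gz); ring.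
Qed.

(** * Moebius transformations *)

Definition mob_num (M : 'M[rat]_2) (R : realFieldType) (x : R) : R :=
  ratr (M 0 0) * x + ratr (M 0 1).

Definition mob_den (M : 'M[rat]_2) (R : realFieldType) (x : R) : R :=
  ratr (M 1 0) * x + ratr (M 1 1).

(** The determinant is taken in [R], next to the other real quantities. *)
Definition rdet (R : realFieldType) (M : 'M[rat]_2) : R :=
  ratr (M 0 0) * ratr (M 1 1) - ratr (M 0 1) * ratr (M 1 0).

Lemma det_mx2 (M : 'M[rat]_2) : \det M = M 0 0 * M 1 1 - M 0 1 * M 1 0.
Proof.
rewrite (expand_det_row M 0) !big_ord_recl big_ord0 addr0 /cofactor !det_mx11.
rewrite !mxE /= expr0 expr1 mul1r mulN1r mulrN.
by congr (_ * M _ _ - M _ _ * M _ _); exact: val_inj.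
Qed.

Lemma rdetE (R : realFieldType) (M : 'M[rat]_2) : rdet R M = ratr (\det M).
Proof. by rewrite det_mx2 rmorphB !rmorphM. Qed.

Lemma unitmx_rdet (R : realFieldType) (M : 'M[rat]_2) :
  (M \in unitmx) = (rdet R M != 0).
Proof. by rewrite unitmxE unitfE rdetE fmorph_eq0. Qed.

Lemma mob_den_poly_neq0 (M : 'M[rat]_2) :
  M \in unitmx -> affpoly (M 1 0) (M 1 1) != 0.
Proof.
rewrite unitmxE unitfE det_mx2 affpoly_eq0; apply: contra =>
  /andP[/eqP-> /eqP->].
by rewrite !mulr0 subrr.
Qed.

(** A fraction of affine polynomials with nonzero determinant is in lowest
    terms, so it has a value only where its own denominator is nonzero. *)
Lemma ratval_mobius (M : 'M[rat]_2) (R : realFieldType) (x m : R) :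
    M \in unitmx ->
  ratval (mobius M) x m <-> mob_den M x != 0 /\ mob_num M x = m * mob_den M x.
Proof.
move=> Mu; rewrite /mobius -!/(affpoly _ _); split=> [xm|[dx nx]]; last first.
  by exists (affpoly (M 0 0) (M 0 1)), (affpoly (M 1 0) (M 1 1));
    rewrite !affpoly_eval -/(mob_num M x) -/(mob_den M x) nx mulfK.
have := ratval_frac (mob_den_poly_neq0 Mu) xm.
rewrite !affpoly_eval -/(mob_num M x) -/(mob_den M x) => nx; split=> //.
apply/eqP => dx; move: Mu; rewrite (unitmx_rdet R) => /eqP; apply.
have {}nx : mob_num M x = 0 by rewrite nx dx mulr0.
move: nx dx; rewrite /mob_num /mob_den /rdet => /addr0_eq <- /addr0_eq <-; ring.
Qed.

(** * The transformation of a pair of triads *)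

(** The correspondence between [x] and its image [m], together with the affine
    map attached to [x], in a form that treats the three components alike. *)
Definition matching (R : realFieldType) (V V' : triad) (x m a b : R) :=
  [/\ a * aeval (tI V) x + b = aeval (tI V') m,
      a * aeval (tJ V) x + b = aeval (tJ V') m &
      a * aeval (tK V) x + b = aeval (tK V') m].

Lemma mulmx22E (A B : 'M[rat]_2) i j :
  (A *m B) i j = A i 0 * B 0 j + A i 1 * B 1 j.
Proof.
rewrite mxE !big_ord_recl big_ord0 addr0.
by congr (_ + A i _ * B _ j); exact: val_inj.
Qed.

(** The four entries of the identity Q' * M = Q. *)
Lemma tmu_entries (V V' : triad) (M : 'M[rat]_2) :
    quot_mx V' \in unitmx -> M = invmx (quot_mx V') *m quot_mx V ->
  [/\ (slope (tK V') - slope (tI V')) * M 0 0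
        + (icept (tK V') - icept (tI V')) * M 1 0 = slope (tK V) - slope (tI V),
      (slope (tK V') - slope (tI V')) * M 0 1
        + (icept (tK V') - icept (tI V')) * M 1 1 = icept (tK V) - icept (tI V),
      (slope (tK V') - slope (tJ V')) * M 0 0
        + (icept (tK V') - icept (tJ V')) * M 1 0 = slope (tK V) - slope (tJ V) &
      (slope (tK V') - slope (tJ V')) * M 0 1
        + (icept (tK V') - icept (tJ V')) * M 1 1
          = icept (tK V) - icept (tJ V)].
Proof.
move=> Q'u ->; set M' := _ *m _.
have e i j : (quot_mx V' *m M') i j = quot_mx V i j by rewrite mulKVmx.
by split; [move: (e 0 0)|move: (e 0 1)|move: (e 1 0)|move: (e 1 1)];
  rewrite mulmx22E ![quot_mx _ _ _]mxE.
Qed.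

Lemma tmu_unit (V V' : triad) :
    quot_mx V \in unitmx -> quot_mx V' \in unitmx ->
  tmu (triad_transf V V') \in unitmx.
Proof. by move=> Vu V'u; rewrite unitmx_mul unitmx_inv V'u. Qed.

Lemma acomp_X (L : affine) :
  acomp L (pfrac 'X) = pfrac (affpoly (slope L) (icept L)).
Proof. by rewrite /acomp -pfracM -pfracD mul_polyC. Qed.

Lemma affpoly_lin (u v a b c d : rat) :
  affpoly (u * a + v * c) (u * b + v * d)
    = u%:P * affpoly a b + v%:P * affpoly c d.
Proof. by rewrite /affpoly -!mul_polyC !(rmorphD, rmorphM) /=; ring. Qed.

Lemma affpolyB (u v u' v' : rat) :
  affpoly u v - affpoly u' v' = affpoly (u - u') (v - v').
Proof. by rewrite /affpoly -!mul_polyC !rmorphB /=; ring. Qed.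

Lemma acomp_frac (L : affine) (n d : {poly rat}) : d != 0 ->
  acomp L (pfrac n / pfrac d) =
    pfrac ((slope L)%:P * n + (icept L)%:P * d) / pfrac d.
Proof.
rewrite -pfrac_eq0 => d0.
by rewrite /acomp pfracD mulrDl !pfracM mulfK // mulrA.
Qed.

(** With K = I + g and K'(mu) = I'(mu) + g/d, as is the case when d is the
    denominator of mu, the two coefficients lose the factor g. *)
Lemma transf_coefs (F : fieldType) (i i' g d : F) : g != 0 -> d != 0 ->
  ((i' + g / d) - i') / ((i + g) - i) = 1 / d /\
  ((i + g) * i' - i * (i' + g / d)) / ((i + g) - i) = i' - i / d.
Proof.
move=> g0 d0; have -> : i + g - i = g by ring.
by split; field; exact/andP.
Qed.

(** The coefficients have the same poles as mu, although their definition
    divides by K - I: the numerator K'(mu) - I'(mu) is (K - I) / d by the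
    choice of mu. *)
Lemma triad_transf_frac (V V' : triad) (T := triad_transf V V') (M := tmu T)
    (d := affpoly (M 1 0) (M 1 1)) :
    quot_mx V \in unitmx -> quot_mx V' \in unitmx ->
  tA T = pfrac 1 / pfrac d /\
  tB T = pfrac ((slope (tI V'))%:P * affpoly (M 0 0) (M 0 1)
                + (icept (tI V'))%:P * d
                - affpoly (slope (tI V)) (icept (tI V))) / pfrac d.
Proof.
move=> Vu V'u.
have d0 : d != 0 by apply: mob_den_poly_neq0; exact: tmu_unit.
have [eI0 eI1 _ _] := tmu_entries V'u (erefl M).
pose g := affpoly (slope (tK V) - slope (tI V)) (icept (tK V) - icept (tI V)).
have g0 : pfrac g != 0.
  rewrite pfrac_eq0 affpoly_eq0; apply/negP => /andP[/eqP k0 /eqP k1].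
  move: Vu; rewrite unitmxE unitfE det_mx2 ![quot_mx _ _ _]mxE /= k0 k1.
  by rewrite !mul0r subrr eqxx.
have KX : acomp (tK V) (pfrac 'X) = acomp (tI V) (pfrac 'X) + pfrac g.
  by rewrite !acomp_X -pfracD /g -affpolyB addrC subrK.
have Kmu : acomp (tK V') (mobius M)
    = acomp (tI V') (mobius M) + pfrac g / pfrac d.
  rewrite /mobius -!/(affpoly _ _) -/d !acomp_frac //.
  rewrite -mulrDl -pfracD /g -eI0 -eI1.
  by rewrite affpoly_lin -/d !polyCB; congr (pfrac _ / _); ring.
have {}d0 : pfrac d != 0 by rewrite pfrac_eq0.
rewrite /T /= -/M KX Kmu.
have [-> ->] := transf_coefs (acomp (tI V) (pfrac 'X)) (acomp (tI V') (mobius M))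
  g0 d0.
split; first by rewrite /pfrac tofrac1.
rewrite acomp_X /mobius -!/(affpoly _ _) -/d.
rewrite acomp_frac; last by rewrite -pfrac_eq0.
by rewrite -mulrBl /pfrac -tofracB.
Qed.

Lemma transf_atE (R : realFieldType) (V V' : triad) (T := triad_transf V V')
    (M := tmu T) (x m a b : R) :
    quot_mx V \in unitmx -> quot_mx V' \in unitmx ->
  transf_at T x m a b <->
  [/\ a * mob_den M x = 1, m = a * mob_num M x &
      a * aeval (tI V) x + b = aeval (tI V') m].
Proof.
move=> Vu V'u; have Mu : M \in unitmx by exact: tmu_unit.
have d0 := mob_den_poly_neq0 Mu.
have [eA eB] := triad_transf_frac Vu V'u.
have nB : (map_poly ratr ((slope (tI V'))%:P * affpoly (M 0 0) (M 0 1)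
    + (icept (tI V'))%:P * affpoly (M 1 0) (M 1 1)
    - affpoly (slope (tI V)) (icept (tI V)))).[x] =
    ratr (slope (tI V')) * mob_num M x + ratr (icept (tI V')) * mob_den M x
    - aeval (tI V) x.
  by rewrite rmorphB rmorphD !rmorphM /= hornerD hornerN hornerD !hornerM
             !affpoly_eval !map_polyC !hornerC.
rewrite /transf_at -/T -/M eA eB; split.
- move=> [/(ratval_mobius x m Mu) [dx nx] Aa Bb].
  have := ratval_frac d0 Aa.
  rewrite rmorph1 hornerC affpoly_eval -/(mob_den M x) => ad.
  have := ratval_frac d0 Bb; rewrite affpoly_eval -/(mob_den M x) nB => bd.
  have em : m = a * mob_num M x by rewrite nx mulrCA -ad mulr1.
  split=> //; apply: (mulIf dx); rewrite mulrDl -bd mulrAC -ad mul1r.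
  by rewrite addrC subrK nx /aeval; ring.
- move=> [ad em eb].
  have dx : mob_den M x != 0.
    by apply: contra_eq_neq ad => ->; rewrite mulr0 eq_sym oner_eq0.
  have ea : a = (mob_den M x)^-1 by apply: (mulIf dx); rewrite ad mulVf.
  split.
  + by apply/(ratval_mobius x m Mu); rewrite em mulrAC ad mul1r.
  + exists 1, (affpoly (M 1 0) (M 1 1)); split=> //; rewrite affpoly_eval //.
    by rewrite rmorph1 hornerC ea div1r.
  + eexists _, (affpoly (M 1 0) (M 1 1)).
    split; [by []|by rewrite affpoly_eval|].
    rewrite nB affpoly_eval -/(mob_den M x) -ea.
    rewrite -[b](addKr (a * aeval (tI V) x)) eb.
    by rewrite /aeval em -[X in _ + (_ + X)]mulr1 -ad; ring.
Qed.

(** Subtracting the matching equations in pairs eliminates b and says that the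
    residues u = m - a N(x) and v = 1 - a D(x) satisfy a linear system of
    nonzero determinant, up to the defects of the equations. *)
Lemma matching_scalars (F : fieldType)
    (i1 i0 j1 j0 k1 k0 i1' i0' j1' j0' k1' k0' M00 M01 M10 M11 x m a b : F) :
    (k1' - i1') * M00 + (k0' - i0') * M10 = k1 - i1 ->
    (k1' - i1') * M01 + (k0' - i0') * M11 = k0 - i0 ->
    (k1' - j1') * M00 + (k0' - j0') * M10 = k1 - j1 ->
    (k1' - j1') * M01 + (k0' - j0') * M11 = k0 - j0 ->
    (k1' - i1') * (k0' - j0') - (k0' - i0') * (k1' - j1') != 0 ->
  [/\ a * (M10 * x + M11) = 1, m = a * (M00 * x + M01) &
      a * (i1 * x + i0) + b = i1' * m + i0'] <->
  [/\ a * (i1 * x + i0) + b = i1' * m + i0',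
      a * (j1 * x + j0) + b = j1' * m + j0' &
      a * (k1 * x + k0) + b = k1' * m + k0'].
Proof.
move=> eI1 eI0 eJ1 eJ0 det0.
set u := m - a * (M00 * x + M01); set v := 1 - a * (M10 * x + M11).
have eI : (k1' - i1') * u + (k0' - i0') * v =
    (a * (i1 * x + i0) + b - (i1' * m + i0'))
    - (a * (k1 * x + k0) + b - (k1' * m + k0')).
  transitivity ((k1' - i1') * m + (k0' - i0')
      - a * ((k1 - i1) * x + (k0 - i0))); last by ring.
  by rewrite -eI1 -eI0 /u /v; ring.
have eJ : (k1' - j1') * u + (k0' - j0') * v =
    (a * (j1 * x + j0) + b - (j1' * m + j0'))
    - (a * (k1 * x + k0) + b - (k1' * m + k0')).
  transitivity ((k1' - j1') * m + (k0' - j0')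
      - a * ((k1 - j1) * x + (k0 - j0))); last by ring.
  by rewrite -eJ1 -eJ0 /u /v; ring.
split=> [[ad em hI]|[hI hJ hK]].
- have u0 : u = 0 by rewrite /u -em subrr.
  have v0 : v = 0 by rewrite /v ad subrr.
  move: eI eJ; rewrite u0 v0 !mulr0 addr0 hI subrr sub0r.
  move=> /esym/eqP; rewrite oppr_eq0 => /eqP hK.
  rewrite hK subr0 => /esym/subr0_eq hJ.
  by split=> //; exact: subr0_eq.
- move: eI eJ; rewrite hI hJ hK !subrr => eI eJ.
  have u0 : u = 0.
    apply: (mulfI det0); rewrite mulr0.
    transitivity ((k0' - j0') * ((k1' - i1') * u + (k0' - i0') * v)
      - (k0' - i0') * ((k1' - j1') * u + (k0' - j0') * v)); first by ring.
    by rewrite eI eJ !mulr0 subrr.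
  have v0 : v = 0.
    apply: (mulfI det0); rewrite mulr0.
    transitivity ((k1' - i1') * ((k1' - j1') * u + (k0' - j0') * v)
      - (k1' - j1') * ((k1' - i1') * u + (k0' - i0') * v)); first by ring.
    by rewrite eI eJ !mulr0 subrr.
  by split=> //; [exact/esym/subr0_eq | exact: subr0_eq].
Qed.

(** All further properties of the transformation are derived from the matching
    equations, which have no denominators, rather than from the formulas. *)
Lemma transf_atP (R : realFieldType) (V V' : triad) (x m a b : R) :
    quot_mx V \in unitmx -> quot_mx V' \in unitmx ->
  transf_at (triad_transf V V') x m a b <-> matching V V' x m a b.
Proof.
move=> Vu V'u; apply: iff_trans (transf_atE _ _ _ _ Vu V'u) _.
have [] := tmu_entries V'u (erefl (tmu (triad_transf V V'))).
move=> /(congr1 (@ratr R)) eI1 /(congr1 (@ratr R)) eI0.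
move=> /(congr1 (@ratr R)) eJ1 /(congr1 (@ratr R)) eJ0.
move: eI1 eI0 eJ1 eJ0; rewrite !(rmorphB, rmorphD, rmorphM) /=.
move: V'u; rewrite (unitmx_rdet R) /rdet ![quot_mx _ _ _]mxE /= !rmorphB.
move=> det0 eI1 eI0 eJ1 eJ0; exact: matching_scalars.
Qed.

Lemma transf_at_exists (R : realFieldType) (V V' : triad) (x : R) :
    quot_mx V \in unitmx -> quot_mx V' \in unitmx ->
    mob_den (tmu (triad_transf V V')) x != 0 ->
  exists m a b, transf_at (triad_transf V V') x m a b.
Proof.
set M := tmu _ => Vu V'u dx.
pose a := (mob_den M x)^-1; pose m := a * mob_num M x.
exists m, a, (aeval (tI V') m - a * aeval (tI V) x).
by apply/transf_atE => //; rewrite -/M mulVf // addrC subrK.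
Qed.

(** For a triad matched with itself the matrix Q^-1 Q is the identity. *)
Lemma matching_id (R : realFieldType) (V : triad) (x m a b : R) :
  quot_mx V \in unitmx -> matching V V x m a b -> [/\ m = x, a = 1 & b = 0].
Proof.
move=> Vu /(transf_atP _ _ _ _ Vu Vu)/(transf_atE _ _ _ _ Vu Vu).
rewrite /= mulVmx // /mob_den /mob_num !mxE /=.
rewrite rmorph1 rmorph0 mul0r add0r mulr1 mul1r.
rewrite addr0 => -[-> ->]; rewrite !mul1r => b0; split=> //.
by apply: (addrI (aeval (tI V) x)); rewrite addr0.
Qed.

Lemma matching_comp (R : realFieldType) (V V' V'' : triad)
    (x m x' a b a' b' : R) :
  matching V V' x m a b -> matching V' V'' m x' a' b' ->
  matching V V'' x x' (a' * a) (a' * b + b').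
Proof.
rewrite /matching => -[<- <- <-] [<- <- <-]; split; ring.
Qed.

(** Composing two matchings in opposite directions matches a triad with
    itself. *)
Lemma triad_transf_inverse (R : realFieldType) (V V' : triad) :
    quot_mx V \in unitmx -> quot_mx V' \in unitmx ->
  inverse_transf R (triad_transf V V') (triad_transf V' V).
Proof.
move=> Vu V'u; split.
  congr mobius => /=; apply: (mulrI (tmu_unit Vu V'u)).
  rewrite mulrV ?tmu_unit //=.
  by rewrite -[LHS]mulmxA mulKVmx // mulVmx.
move=> x m a b x' a' b' /(transf_atP _ _ _ _ Vu V'u) h.
move=> /(transf_atP _ _ _ _ V'u Vu) /(matching_comp h) /(matching_id Vu).
move=> [-> a1 b0]; split=> // z.
by rewrite mulrDr mulrA a1 mul1r -addrA b0 addr0.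
Qed.

Lemma triad_transf_id (V : triad) :
  quot_mx V \in unitmx -> trivial_transf (triad_transf V V).
Proof.
move=> Vu; have [eA eB] := triad_transf_frac Vu Vu.
split; rewrite ?eA ?eB /= mulVmx // !mxE /=.
- have -> : affpoly 0 1 = 1 by rewrite /affpoly scale0r add0r.
  by rewrite divff // pfrac_eq0 oner_eq0.
- have -> : affpoly 0 1 = 1 by rewrite /affpoly scale0r add0r.
  rewrite /affpoly scale1r addr0 mulr1 mul_polyC subrr.
  by rewrite /pfrac tofrac0 mul0r.
Qed.

(** * Germs at the X-point *)

Lemma cvg_affine (R : realFieldType) (u v x0 : R) :
  (fun x => u * x + v) @ x0 --> u * x0 + v.
Proof.
apply: (@cvgD _ _ _ _ _ (fun x => u * x) (fun=> v)); last exact: cvg_cst.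
by apply: (@cvgM _ _ _ _ (fun=> u) id); [exact: cvg_cst|exact: cvg_id].
Qed.

Lemma near_affine_sign (R : realFieldType) (u v x0 : R) :
  u * x0 + v != 0 -> \forall x \near x0, 0 < (u * x0 + v) * (u * x + v).
Proof.
move=> c0; set c := u * x0 + v in c0 *.
have cv : (fun x => c * (u * x + v)) @ x0 --> c * c.
  apply: (@cvgM _ _ _ _ (fun=> c) (fun x => u * x + v)); first exact: cvg_cst.
  exact: cvg_affine.
by apply: cvgr_gt cv _ _; rewrite -expr2 exprn_even_gt0.
Qed.

Lemma near_mob_den_neq0 (M : 'M[rat]_2) (R : realFieldType) (x0 : R) :
  mob_den M x0 != 0 -> \forall x \near x0, mob_den M x != 0.
Proof.
move=> /near_affine_sign; apply: filterS => x; apply: contraTneq.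
by rewrite /mob_den => ->; rewrite mulr0 ltxx.
Qed.

Lemma mobius_near (M : 'M[rat]_2) (R : realFieldType) (x0 : R)
    (P : set R) :
    M \in unitmx -> ratval (mobius M) x0 x0 -> nbhs x0 P ->
  \forall x \near x0, forall m, ratval (mobius M) x m -> P m.
Proof.
move=> Mu /(ratval_mobius x0 x0 Mu) [d0 n0] Px0.
have cv : (fun x => mob_num M x / mob_den M x) @ x0 --> x0.
  rewrite -[X in _ --> X](mulfK d0) -n0.
  apply: (@cvgM _ _ _ _ (@mob_num M R) (fun x => (mob_den M x)^-1)).
    exact: cvg_affine.
  by apply: (@cvgV _ _ _ _ (@mob_den M R)) => //; exact: cvg_affine.
have : \forall x \near x0, P (mob_num M x / mob_den M x) by exact: cv.
apply: filterS => x Px m /(ratval_mobius x m Mu) [dx nx].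
by move: Px; rewrite nx mulfK.
Qed.

(** By the identity m - x0 = det M * (x - x0) / (D(x) D(x0)), for the
    denominator D, the side of the image is governed by the sign of the
    determinant. *)
Lemma mobius_side (M : 'M[rat]_2) (R : realFieldType) (x0 : R) :
    M \in unitmx -> ratval (mobius M) x0 x0 ->
  \forall x \near x0, forall m, ratval (mobius M) x m -> x != x0 ->
    0 < (m - x0) * (x - x0) * rdet R M.
Proof.
move=> Mu /(ratval_mobius x0 x0 Mu) [d0 n0].
have := near_affine_sign d0; apply: filterS => x dd m.
move=> /(ratval_mobius x m Mu) [dx nx] xx0.
rewrite -/(mob_den M x0) -/(mob_den M x) in dd.
have det0 : rdet R M != 0 by rewrite -unitmx_rdet.
have e : (m - x0) * (mob_den M x0 * mob_den M x) = rdet R M * (x - x0).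
  transitivity (mob_den M x0 * mob_num M x
    - mob_num M x0 * mob_den M x); last first.
    by rewrite /mob_den /mob_num /rdet; ring.
  by rewrite nx n0; ring.
rewrite -(pmulr_lgt0 _ dd).
have -> : (m - x0) * (x - x0) * rdet R M * (mob_den M x0 * mob_den M x)
    = (rdet R M * (x - x0)) ^+ 2.
  rewrite expr2 -{1}e; ring.
by rewrite exprn_even_gt0 //= mulf_neq0 // subr_eq0.
Qed.

(** By continuity, a strict order at p persists nearby. *)
Lemma affine_germ_lt (R : realFieldType) (p : rat) (F : set_system R)
    {FF : ProperFilter F} (L L' : affine) : F `=>` nbhs (ratr p : R) ->
    aeval L p != aeval L' p ->
    (\forall x \near F, aeval L x < aeval L' x) -> aeval L p < aeval L' p.
Proof.
move=> Fp neq lt; rewrite -(ltr_rat R) -!aeval_ratr -subr_gt0.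
have e (x : R) : aeval L' x - aeval L x = (ratr (slope L') - ratr (slope L)) * x
    + (ratr (icept L') - ratr (icept L)) by rewrite /aeval; ring.
have : aeval L' (ratr p : R) - aeval L (ratr p) != 0.
  by rewrite !aeval_ratr -rmorphB fmorph_eq0 subr_eq0 eq_sym.
rewrite e => /near_affine_sign/Fp sgn.
have [x []] := filter_ex (filterI lt sgn).
by rewrite -!e -subr_gt0 => xpos; rewrite pmulr_lgt0.
Qed.

Lemma affine_diff (R : realFieldType) (p : rat) (L L' : affine) (x : R) :
    aeval L p = aeval L' p ->
  aeval L x - aeval L' x = ratr (slope L - slope L') * (x - ratr p).
Proof.
move=> /(congr1 (@ratr R)); rewrite -!aeval_ratr => /eqP.
rewrite -subr_eq0 => /eqP e; rewrite -[LHS]subr0 -e /aeval rmorphB; ring.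
Qed.

Lemma slope_right (R : realFieldType) (p : rat) (L L' : affine) :
    aeval L p = aeval L' p ->
    (\forall x \near (ratr p : R)^'+, aeval L x < aeval L' x) ->
  slope L < slope L'.
Proof.
move=> Lp lt; near (ratr p : R)^'+ => x.
have lx : aeval L x < aeval L' x by near: x.
have px : ratr p < x by near: x; exact: nbhs_right_gt.
move: lx; rewrite -subr_lt0 (affine_diff _ Lp).
rewrite -(subr_gt0 (ratr p)) in px.
by rewrite pmulr_llt0 // ltrq0 subr_lt0.
Unshelve. all: by end_near. Qed.

Lemma slope_left (R : realFieldType) (p : rat) (L L' : affine) :
    aeval L p = aeval L' p ->
    (\forall x \near (ratr p : R)^'-, aeval L x < aeval L' x) ->
  slope L' < slope L.
Proof.
move=> Lp lt; near (ratr p : R)^'- => x.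
have lx : aeval L x < aeval L' x by near: x.
have px : x < ratr p by near: x; exact: nbhs_left_lt.
move: lx; rewrite -subr_lt0 (affine_diff _ Lp).
rewrite -subr_lt0 in px.
by rewrite nmulr_llt0 // ltr0q subr_gt0.
Unshelve. all: by end_near. Qed.

(** Translating the variable by p does not change the determinant, and at p
    the two rows of the translated matrix have the same constant term. *)
Lemma det_quot (p : rat) (V : triad) : aeval (tJ V) p = aeval (tI V) p ->
  \det (quot_mx V)
    = (slope (tJ V) - slope (tI V)) * (aeval (tK V) p - aeval (tI V) p).
Proof.
rewrite /aeval !ratr_ratE => JI.
rewrite det_mx2 ![quot_mx _ _ _]mxE /=.
rewrite (_ : icept (tJ V) = slope (tI V) * p + icept (tI V) - slope (tJ V) * p).
  ring.
by rewrite -JI; ring.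
Qed.

(** What the two order conditions of a pseudotriad have in common.  This
    condition is invariant under the exchange of the two triads, so that what
    is proved for the transformation applies to its inverse. *)
Record opposed (p : rat) (V V' : triad) : Prop := Opposed {
  opposed_J : aeval (tJ V) p = aeval (tI V) p;
  opposed_I' : aeval (tI V') p = aeval (tI V) p;
  opposed_J' : aeval (tJ V') p = aeval (tI V') p;
  opposed_K : (aeval (tK V) p - aeval (tI V) p)
              * (aeval (tK V') p - aeval (tI V') p) < 0;
  opposed_slope : 0 < (slope (tI V) - slope (tJ V))
                      * (slope (tI V') - slope (tJ V')) }.

Lemma opposed_sym p V V' : opposed p V V' -> opposed p V' V.
Proof. by case=> J I' J' K s; split=> //; rewrite mulrC. Qed.

Lemma opposed_unit p V V' : opposed p V V' -> quot_mx V \in unitmx.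
Proof.
case=> J _ _ K s; rewrite unitmxE unitfE (det_quot J) -opprB mulNr oppr_eq0.
rewrite mulf_neq0 //.
  by apply: contraTneq s => ->; rewrite mul0r ltxx.
by apply: contraTneq K => ->; rewrite mul0r ltxx.
Qed.

Lemma opposed_det p V V' : opposed p V V' ->
  \det (tmu (triad_transf V V')) < 0.
Proof.
move=> o; have [J I' J' K s] := o.
have := congr1 determinant (mulKVmx (opposed_unit (opposed_sym o)) (quot_mx V)).
rewrite -/(tmu (triad_transf V V')) det_mulmx (det_quot J) (det_quot J').
move: (\det _) => D.
rewrite -(opprB (slope (tI V'))) -(opprB (slope (tI V))) !mulNr.
move=> /oppr_inj.
move: s K; move: (slope (tI V) - _) (slope (tI V') - _) => s1 s2.
move: (aeval (tK V) p - _) (aeval (tK V') p - _) => k1 k2 ss kk e.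
have sq : 0 < (s2 * k2) ^+ 2.
  rewrite exprn_even_gt0 //= mulf_neq0 //.
    by apply: contraTneq ss => ->; rewrite mulr0 ltxx.
  by apply: contraTneq kk => ->; rewrite mulr0 ltxx.
rewrite -(pmulr_rlt0 _ sq).
have -> : (s2 * k2) ^+ 2 * D = s1 * s2 * (k1 * k2).
  by rewrite expr2 -mulrA e; ring.
by rewrite pmulr_rlt0.
Qed.

(** The matching equations at x = m = p: the first two say that the affine
    map fixes the ordinate of the X-point, the third determines its slope. *)
Lemma opposed_ratval (R : realFieldType) p V V' : opposed p V V' ->
  ratval (mobius (tmu (triad_transf V V'))) (ratr p : R) (ratr p).
Proof.
move=> o; have [J I' J' K s] := o.
pose a := (aeval (tK V') p - aeval (tI V') p)
  / (aeval (tK V) p - aeval (tI V) p).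
pose b := aeval (tI V) p - a * aeval (tI V) p.
suff : matching V V' (ratr p : R) (ratr p) (ratr a) (ratr b).
  by move/(transf_atP _ _ _ _
    (opposed_unit o) (opposed_unit (opposed_sym o))) => [].
rewrite /matching !aeval_ratr -!rmorphM -!rmorphD; split; congr ratr.
- by rewrite I' /b addrC subrK.
- by rewrite J' I' J /b addrC subrK.
rewrite /b addrA addrAC -mulrBr /a divfK; first by rewrite I' subrK.
by apply: contraTneq K => ->; rewrite mul0r ltxx.
Qed.

Lemma opposed_near (R : realFieldType) p V V' (T := triad_transf V V') :
    opposed p V V' ->
  \forall x \near (ratr p : R), exists m a b,
    [/\ transf_at T x m a b, matching V V' x m a b &
        x != ratr p -> (m - ratr p) * (x - ratr p) < 0].
Proof.
move=> o.
have [Vu V'u] := (opposed_unit o, opposed_unit (opposed_sym o)).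
have Tu := tmu_unit Vu V'u.
have Tp := opposed_ratval R o.
have [dp _] := (ratval_mobius (ratr p) (ratr p) Tu).1 Tp.
have := mobius_side Tu Tp; have := near_mob_den_neq0 dp.
apply: filterS2 => x dx side.
have [m [a [b t]]] := transf_at_exists Vu V'u dx.
exists m, a, b; split=> //; first exact/transf_atP.
move=> xp; case: t => /side/(_ xp) + _ _.
by rewrite rdetE nmulr_lgt0 // ltrq0 (opposed_det o).
Qed.

(** * Triples of values separated by their gaps *)

Lemma perm_three (T : eqType) (x y z x' y' z' : T) :
    perm_eq [:: x; y; z] [:: x'; y'; z'] ->
  [\/ x = x' /\ (y = y' /\ z = z' \/ y = z' /\ z = y'),
      x = y' /\ (y = x' /\ z = z' \/ y = z' /\ z = x') |
      x = z' /\ (y = x' /\ z = y' \/ y = y' /\ z = x')].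
Proof.
have one (u u' : T) : perm_eq [:: u] [:: u'] -> u = u'.
  by move=> /perm_mem/(_ u); rewrite !inE eqxx => /esym/eqP.
have two (u v u' v' : T) : perm_eq [:: u; v] [:: u'; v'] ->
    (u = u' /\ v = v') \/ (u = v' /\ v = u').
  move=> h; have : u \in [:: u'; v'] by rewrite -(perm_mem h) !inE eqxx.
  rewrite !inE => /orP[] /eqP e; move: h; rewrite e.
    by rewrite perm_cons => /one ->; left.
  by rewrite perm_sym (perm_catC [:: u'] [:: v']) /= perm_cons => /one ->; right.
move=> h; have : x \in [:: x'; y'; z'] by rewrite -(perm_mem h) !inE eqxx.
rewrite !inE => /or3P[] /eqP e; move: h; rewrite e.
- by rewrite perm_cons => /two ?; apply: Or31.
- rewrite perm_sym (perm_catCA [:: x'] [:: y'] [:: z']) perm_sym /= perm_cons.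
  by move=> /two ?; apply: Or32.
- rewrite perm_sym (perm_catC [:: x'; y'] [:: z']) perm_sym /= perm_cons.
  by move=> /two ?; apply: Or33.
Qed.

(** Products and squares make the condition insensitive to reversing the order
    of the line, so that one condition covers the two orders of a pseudotriad. *)
Definition separated (R : realFieldType) (V : triad) (x : R) : Prop :=
  0 < (aeval (tI V) x - aeval (tJ V) x) * (aeval (tK V) x - aeval (tI V) x) /\
  (aeval (tI V) x - aeval (tJ V) x) ^+ 2
    < (aeval (tK V) x - aeval (tI V) x) ^+ 2.

(** Among the six possible bijections, only the one given by the order of the
    triples preserves both the middle value and the comparison of the two
    gaps. *)
Lemma separated_affine (R : realFieldType) (i j k i' j' k' a b : R) :
    0 < (i - j) * (k - i) -> (i - j) ^+ 2 < (k - i) ^+ 2 ->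
    0 < (i' - j') * (k' - i') -> (i' - j') ^+ 2 < (k' - i') ^+ 2 ->
    perm_eq [:: a * i + b; a * j + b; a * k + b] [:: i'; j'; k'] ->
  [/\ a * i + b = i', a * j + b = j' & a * k + b = k'].
Proof.
move=> mid gap mid' gap' /perm_three.
have e : a * (i - j) = (a * i + b) - (a * j + b) by ring.
have g : a * (k - i) = (a * k + b) - (a * i + b) by ring.
have pos : 0 <= (a * (i - j)) * (a * (k - i)).
  by rewrite mulrACA -expr2 mulr_ge0 ?sqr_ge0 // ltW.
have sq : (a * (i - j)) ^+ 2 <= (a * (k - i)) ^+ 2.
  by rewrite !exprMn ler_wpM2l ?sqr_ge0 // ltW.
move: pos sq; rewrite e g => {e g mid gap}.
have e0 := sqr_ge0 (i' - j'); have g0 := sqr_ge0 (k' - i').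
by move=> pos sq [[ei [[ej ek]|[ej ek]]]|[ei [[ej ek]|[ej ek]]]|
  [ei [[ej ek]|[ej ek]]]]; rewrite ei ej ek in pos sq *; first (by []);
  exfalso; nra.
Qed.

(** The middle condition holds on one side of p only, given by the sign of
    I - J.  The gap condition holds all around p, as (K-I)^2 - (I-J)^2 is the
    product of two affine functions with the same nonzero value at p. *)
Lemma separated_near (R : realFieldType) (p : rat) (V : triad) :
    aeval (tJ V) p = aeval (tI V) p -> aeval (tK V) p != aeval (tI V) p ->
  \forall x \near (ratr p : R),
    0 < ratr ((slope (tI V) - slope (tJ V)) * (aeval (tK V) p - aeval (tI V) p))
        * (x - ratr p) ->
    separated V x.
Proof.
move=> JI KI; set kap := aeval _ _ - _.
have kap0 : kap != 0 by rewrite subr_eq0.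
have KIE (x : R) : aeval (tK V) x - aeval (tI V) x =
    ratr (slope (tK V) - slope (tI V)) * (x - ratr p) + ratr kap.
  have -> : ratr kap = aeval (tK V) (ratr p : R) - aeval (tI V) (ratr p).
    by rewrite !aeval_ratr -rmorphB.
  by rewrite /aeval rmorphB; ring.
have IJE (x : R) := affine_diff x (esym JI).
clearbody kap.
have pos u : \forall x \near (ratr p : R),
    0 < ratr kap * (u * (x - ratr p) + ratr kap).
  have : u * ratr p + (ratr kap - u * ratr p) != 0 :> R.
    by rewrite addrC subrK fmorph_eq0.
  move=> /near_affine_sign; apply: filterS => x.
  by rewrite addrC subrK mulrBr addrA addrAC.
have sep x (u := ratr (slope (tK V) - slope (tI V)))
    (v := ratr (slope (tI V) - slope (tJ V))) :
    0 < ratr kap * (u * (x - ratr p) + ratr kap) ->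
    0 < ratr kap * ((u - v) * (x - ratr p) + ratr kap) ->
    0 < ratr kap * ((u + v) * (x - ratr p) + ratr kap) ->
    0 < ratr ((slope (tI V) - slope (tJ V)) * kap) * (x - ratr p) :> R ->
  separated V x.
  rewrite rmorphM /= /separated KIE IJE -/u -/v; move: u v => u v.
  have : 0 < ratr kap ^+ 2 :> R by rewrite exprn_even_gt0 // fmorph_eq0.
  move: (x - _) (ratr kap) => {}x k k2 ku kum kup s.
  split.
    by rewrite -(pmulr_rgt0 _ k2); nra.
  rewrite -subr_gt0 -(pmulr_rgt0 _ k2).
  have -> : k ^+ 2 * ((u * x + k) ^+ 2 - (v * x) ^+ 2) =
    (k * ((u - v) * x + k)) * (k * ((u + v) * x + k)) by ring.
  exact: mulr_gt0.
have pu := pos (ratr (slope (tK V) - slope (tI V))).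
have pm := pos (ratr (slope (tK V) - slope (tI V))
  - ratr (slope (tI V) - slope (tJ V))).
have pp := pos (ratr (slope (tK V) - slope (tI V))
  + ratr (slope (tI V) - slope (tJ V))).
by near=> x; apply: sep; near: x.
Unshelve. all: by end_near. Qed.

(** * Self-equivalences on one side of the X-point *)

Definition side (R : realFieldType) (p : rat) (W W' : triad) (x : R) : triad :=
  if ratr p <= x then W else W'.

Lemma OmegaE (R : realFieldType) (p : rat) (W W' : triad) (x : R) :
  Omega p W W' x = values (side p W W' x) x.
Proof. by rewrite /Omega /side; case: ifP. Qed.

(** The situation of a filter on one side of p: [V] is the triad in force on
    its side and [V'] the one in force on the other.  The left-hand and the
    right-hand statements are instances of a single one. *)
Definition one_sided (R : realFieldType) (p : rat) (W W' : triad)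
    (F : set_system R) (V V' : triad) : Prop :=
  F `=>` (ratr p : R)^' /\
  \forall x \near F, side p W W' x = V /\
    forall m, (0 < (m - ratr p) * (x - ratr p) -> side p W W' m = V) /\
              ((m - ratr p) * (x - ratr p) < 0 -> side p W W' m = V').

Lemma one_sided_right (R : realFieldType) (p : rat) (W W' : triad) :
  one_sided p W W' (ratr p : R)^'+ W W'.
Proof.
split.
  move=> A; rewrite /at_right /at_left /dnbhs /within /=.
  by apply: filterS => x h px; apply: h; rewrite gt_eqF.
near=> x; have px : ratr p < x by near: x; exact: nbhs_right_gt.
rewrite -(subr_gt0 (ratr p)) in px.
rewrite /side -subr_ge0 ltW //; split=> // m; split.
  by rewrite pmulr_lgt0 // -(subr_ge0 _ m) => /ltW ->.
by rewrite pmulr_llt0 // subr_lt0 leNgt => ->.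
Unshelve. all: by end_near. Qed.

Lemma one_sided_left (R : realFieldType) (p : rat) (W W' : triad) :
  one_sided p W W' (ratr p : R)^'- W' W.
Proof.
split.
  move=> A; rewrite /at_right /at_left /dnbhs /within /=.
  by apply: filterS => x h px; apply: h; rewrite lt_eqF.
near=> x; have px : x < ratr p by near: x; exact: nbhs_left_lt.
rewrite /side leNgt px; split=> // m; rewrite -subr_lt0 in px; split.
  by rewrite nmulr_lgt0 // subr_lt0 leNgt => ->.
by rewrite nmulr_llt0 // subr_gt0 => /ltW ->.
Unshelve. all: by end_near. Qed.

Lemma same_transf_germ (R : realFieldType) (x0 : R) (F : set_system R)
    {FF : ProperFilter F} (S T : transf) : F `=>` x0^' ->
    (\forall x \near F, exists m a b,
        transf_at S x m a b /\ transf_at T x m a b) ->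
  same_transf S T.
Proof.
move=> Fx0 ST; split; apply: (ratfun_ext Fx0); 
  apply: filterS ST => x [m [a [b [[mS aS bS] [mT aT bT]]]]].
- by exists m.
- by exists a.
- by exists b.
Qed.

(** The determinant is negative, whence the exchange of the two sides of p. *)
Lemma opposed_near_side (R : realFieldType) p (F : set_system R)
    {FF : Filter F} V V' (T := triad_transf V V') : opposed p V V' ->
    F `=>` (ratr p : R)^' ->
  \forall x \near F, exists m a b, [/\ transf_at T x m a b,
      matching V V' x m a b & (m - ratr p) * (x - ratr p) < 0].
Proof.
move=> o Fp; have near_x := Fp _ (nbhs_dnbhs (opposed_near R o)).
have neq := Fp _ (@nbhs_dnbhs_neq _ (ratr p : R)).
near=> x.
have xp : x != ratr p by near: x.
have [m [a [b [t h]]]] : exists m a b,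
    [/\ transf_at T x m a b, matching V V' x m a b &
        x != ratr p -> (m - ratr p) * (x - ratr p) < 0] by near: x.
by move=> /(_ xp); exists m, a, b.
Unshelve. all: by end_near. Qed.

Lemma self_equiv_exists (R : realFieldType) p W W' (F : set_system R)
    {FF : Filter F} V V' :
    opposed p V V' -> one_sided p W W' F V V' ->
  local_self_equiv F p W W' (triad_transf V V').
Proof.
move=> o [Fp sides]; split.
- exact: tmu_unit (opposed_unit o) (opposed_unit (opposed_sym o)).
- exact: opposed_ratval o.
have := opposed_near_side (FF := FF) o Fp; apply: filterS2 sides => x.
move=> [sx sm] [m [a [b [t [eI eJ eK] opp]]]].
exists m, a, b; split=> //.
by rewrite !OmegaE sx ((sm m).2 opp) /values /= eI eJ eK.
Qed.

(** Images of points close to p are close to p, where the values are separated,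
    so that the components match one by one.  The sign of the determinant
    then tells which triad is met at the image: the same one, and the
    transformation is trivial, or the other one, and it is the expected one. *)
Lemma self_equiv_unique (R : realFieldType) p W W' (F : set_system R)
    {FF : ProperFilter F} V V' S :
    opposed p V V' -> one_sided p W W' F V V' ->
    (\forall x \near (ratr p : R),
        x != ratr p -> separated (side p W W' x) x) ->
    ~ trivial_transf S -> local_self_equiv F p W W' S ->
  same_transf S (triad_transf V V').
Proof.
move=> o [Fp sides] sep Snt [Su Sp Sn].
have [Vu V'u] := (opposed_unit o, opposed_unit (opposed_sym o)).
have components : \forall x \near F, exists m a b,
    [/\ transf_at S x m a b, matching V (side p W W' m) x m a b &
        0 < (m - ratr p) * (x - ratr p) * ratr (\det (tmu S))].
  have near_m := Fp _ (nbhs_dnbhs (mobius_near Su Sp sep)).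
  have near_s := Fp _ (nbhs_dnbhs (mobius_side Su Sp)).
  have near_x := Fp _ (nbhs_dnbhs sep).
  have neq := Fp _ (@nbhs_dnbhs_neq _ (ratr p : R)).
  near=> x.
  have xp : x != ratr p by near: x.
  have [sx _] : side p W W' x = V /\
    forall m, (0 < (m - ratr p) * (x - ratr p) -> side p W W' m = V) /\
              ((m - ratr p) * (x - ratr p) < 0 -> side p W W' m = V') by near: x.
  have [m [a [b [t perm]]]] : exists m a b : R, transf_at S x m a b /\
    perm_eq [seq a * z + b | z <- Omega p W W' x] (Omega p W W' m) by near: x.
  have [tm _ _] := t.
  have mx : forall m, ratval (mobius (tmu S)) x m -> x != ratr p ->
    0 < (m - ratr p) * (x - ratr p) * rdet R (tmu S) by near: x.
  have {mx} := mx m tm xp; rewrite rdetE => mx.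
  have mp : m != ratr p.
    by apply: contraTneq mx => ->; rewrite subrr !mul0r ltxx.
  have [] : separated (side p W W' x) x by move: xp; near: x.
  have [] : separated (side p W W' m) m.
    move: m tm mp {t perm mx}; near: x; exact: near_m.
  rewrite sx => mid' gap' mid gap.
  exists m, a, b; split=> //.
  move: perm; rewrite !OmegaE sx => perm.
  exact: separated_affine mid gap mid' gap' perm.
(* A positive determinant preserves the sides of p, a negative one exchanges
   them. *)
have [Dpos|Dneg|D0] := ltrgt0P (\det (tmu S)).
- case: Snt; have [eM eA eB] := triad_transf_id Vu.
  suff [fM fA fB] : same_transf S (triad_transf V V).
    by split; [rewrite fM|rewrite fA|rewrite fB].
  apply: (same_transf_germ Fp); apply: filterS2 sides components => x.
  move=> [_ sm] [m [a [b [t h]]]]; rewrite pmulr_lgt0 ?ltr0q // => /(sm m).1 mV.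
  by rewrite mV in h; exists m, a, b; split=> //; exact/transf_atP.
- apply: (same_transf_germ Fp); apply: filterS2 sides components => x.
  move=> [_ sm] [m [a [b [t h]]]]; rewrite nmulr_lgt0 ?ltrq0 // => /(sm m).2 mV.
  by rewrite mV in h; exists m, a, b; split=> //; exact/transf_atP.
- by move: Su; rewrite unitmxE unitfE D0 eqxx.
Unshelve. all: by end_near. Qed.

(** * The sign conditions of a pseudotriad *)

(** An order near p gives the order of the slopes for two lines that meet at
    p, and the order of the values at p for two lines that do not. *)
Lemma pseudotriad_signs (R : realFieldType) (p : rat) (W W' : triad) :
    pseudotriad R p W W' ->
  [/\ opposed p W W',
      0 < (slope (tI W) - slope (tJ W)) * (aeval (tK W) p - aeval (tI W) p) &
      (slope (tI W') - slope (tJ W')) * (aeval (tK W') p - aeval (tI W') p) < 0].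
Proof.
move=> [[JI I'I J'I] KI K'I _ ord].
have J'I' : aeval (tJ W') p = aeval (tI W') p by rewrite J'I.
rewrite -I'I in K'I.
have rp : (ratr p : R)^'+ `=>` nbhs (ratr p : R) by exact: cvg_within.
have lp : (ratr p : R)^'- `=>` nbhs (ratr p : R) by exact: cvg_within.
suff : [/\ slope (tJ W) < slope (tI W), aeval (tI W) p < aeval (tK W) p,
           slope (tJ W') < slope (tI W') & aeval (tK W') p < aeval (tI W') p] \/
       [/\ slope (tI W) < slope (tJ W), aeval (tK W) p < aeval (tI W) p,
           slope (tI W') < slope (tJ W') & aeval (tI W') p < aeval (tK W') p].
  move=> s; split; first split=> //; by case: s => -[]; nra.
case: ord => -[r l]; [left|right]; split.
- by apply: (slope_right JI); apply: filterS r => x /andP[].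
- apply: (affine_germ_lt rp); first by rewrite eq_sym.
  by apply: filterS r => x /andP[].
- by apply: (slope_left (esym J'I')); apply: filterS l => x /andP[].
- by apply: (affine_germ_lt lp) => //; apply: filterS l => x /andP[].
- by apply: (slope_right (esym JI)); apply: filterS r => x /andP[].
- by apply: (affine_germ_lt rp) => //; apply: filterS r => x /andP[].
- by apply: (slope_left J'I'); apply: filterS l => x /andP[].
- apply: (affine_germ_lt lp); first by rewrite eq_sym.
  by apply: filterS l => x /andP[].
Qed.

Lemma pseudotriad_separated (R : realFieldType) (p : rat) (W W' : triad) :
    pseudotriad R p W W' ->
  \forall x \near (ratr p : R), x != ratr p -> separated (side p W W' x) x.
Proof.
move=> /pseudotriad_signs [[JI _ J'I' kk _] pos neg].
have KI : aeval (tK W) p != aeval (tI W) p.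
  by rewrite -subr_eq0; apply: contraTneq kk => ->; rewrite mul0r ltxx.
have K'I' : aeval (tK W') p != aeval (tI W') p.
  by rewrite -subr_eq0; apply: contraTneq kk => ->; rewrite mulr0 ltxx.
have := separated_near R J'I' K'I'; have := separated_near R JI KI.
apply: filterS2 => x sW sW' xp; rewrite /side; case: leP => px.
  by apply: sW; rewrite mulr_gt0 ?ltr0q // subr_gt0 lt_neqAle eq_sym xp.
by apply: sW'; rewrite nmulr_rgt0 ?ltrq0 // subr_lt0.
Qed.

(** * The collineation *)

Lemma row3_ext (v w : 'rV[rat]_3) :
  v 0 0 = w 0 0 -> v 0 1 = w 0 1 -> v 0 ord_max = w 0 ord_max -> v = w.
Proof.
move=> e0 e1 e2; apply/rowP => -[[|[|[|k]]] // h].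
- by have -> : Ordinal h = 0 by exact: val_inj.
- by have -> : Ordinal h = 1 by exact: val_inj.
- by have -> : Ordinal h = ord_max by exact: val_inj.
Qed.

(** The linear form of a line, whose vanishing means incidence.  Its actual
    value is used, as it also encodes the proportionality factor. *)
Definition incid (v : 'rV[rat]_3) (L : affine) : rat := (v *m line_of L) 0 0.

Lemma mul_row_col3 (v : 'rV[rat]_3) (l : 'cV[rat]_3) :
  (v *m l) 0 0 = v 0 0 * l 0 0 + v 0 1 * l 1 0 + v 0 ord_max * l ord_max 0.
Proof.
rewrite mxE !big_ord_recl big_ord0 addr0 addrA.
by congr (_ + v _ _ * l _ _ + v _ _ * l _ _); exact: val_inj.
Qed.

Lemma incidE (v : 'rV[rat]_3) (L : affine) :
  incid v L = v 0 0 * slope L - v 0 1 + v 0 ord_max * icept L.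
Proof. by rewrite /incid mul_row_col3 !mxE /= mulrN1. Qed.

Lemma incid0 (v : 'rV[rat]_3) (l : 'cV[rat]_3) : (v *m l) 0 0 = 0 <-> v *m l = 0.
Proof.
by split=> [h|->]; [apply/matrixP => i j; rewrite !ord1 h mxE|rewrite mxE].
Qed.

Lemma incid_pt (x y : rat) (L : affine) : incid (pt x y) L = aeval L x - y.
Proof. by rewrite incidE !mxE /= /aeval !ratr_ratE mul1r mulrC addrAC. Qed.

Lemma incid_o_infty (L : affine) : incid o_infty L = -1.
Proof. by rewrite incidE !mxE /= !mul0r sub0r addr0. Qed.

Definition triad_mx (V : triad) : 'M[rat]_3 :=
  \matrix_(i, j)
     ([:: line_of (tI V); line_of (tJ V); line_of (tK V)]`_j) i 0.

Lemma mul_triad_mx (v : 'rV[rat]_3) (V : triad) :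
  v *m triad_mx V = row3 (incid v (tI V)) (incid v (tJ V)) (incid v (tK V)).
Proof.
by apply: row3_ext; rewrite [RHS]mxE /= /incid !mul_row_col3 mxE !big_ord_recl
  big_ord0 addr0 addrA !mxE /=;
  congr (_ + v _ _ * _ + v _ _ * _); exact: val_inj.
Qed.

(** The three lines of a triad are not concurrent: eliminating the second
    coordinate leaves the system of matrix Q. *)
Lemma triad_mx_inj (V : triad) (v w : 'rV[rat]_3) :
    quot_mx V \in unitmx -> incid v (tI V) = incid w (tI V) ->
    incid v (tJ V) = incid w (tJ V) -> incid v (tK V) = incid w (tK V) -> v = w.
Proof.
rewrite unitmxE unitfE det_mx2 ![quot_mx _ _ _]mxE /= !incidE => det0 eI eJ eK.
set a := v 0 0 - w 0 0; set c := v 0 ord_max - w 0 ord_max.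
have h1 : a * (slope (tK V) - slope (tI V))
          + c * (icept (tK V) - icept (tI V)) = 0 by rewrite /a /c; lra.
have h2 : a * (slope (tK V) - slope (tJ V))
          + c * (icept (tK V) - icept (tJ V)) = 0 by rewrite /a /c; lra.
move: det0 h1 h2 {eJ eK}.
move: (slope (tK V) - slope (tI V)) (slope (tK V) - slope (tJ V)).
move: (icept (tK V) - icept (tI V)) (icept (tK V) - icept (tJ V)).
move=> k l s t det0 h1 h2.
have a0 : a = 0.
  apply: (mulIf det0); rewrite mul0r.
  transitivity ((a * s + c * k) * l - (a * t + c * l) * k); first by ring.
  by rewrite h1 h2 !mul0r subrr.
have c0 : c = 0.
  apply: (mulIf det0); rewrite mul0r.
  transitivity ((a * t + c * l) * s - (a * s + c * k) * t); first by ring.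
  by rewrite h1 h2 !mul0r subrr.
have ev := subr0_eq a0; have ec := subr0_eq c0.
by apply: row3_ext => //; move: eI; rewrite ev ec; lra.
Qed.

Lemma triad_mx_unit (V : triad) :
  quot_mx V \in unitmx -> triad_mx V \in unitmx.
Proof.
move=> Vu; rewrite -row_free_unit; apply: inj_row_free => v v0.
apply: (triad_mx_inj Vu); rewrite [RHS]/incid mul0mx mxE.
- by have := congr1 (fun u : 'rV_3 => u 0 0) v0; rewrite mul_triad_mx !mxE.
- by have := congr1 (fun u : 'rV_3 => u 0 1) v0; rewrite mul_triad_mx !mxE.
- by have := congr1 (fun u : 'rV_3 => u 0 ord_max) v0; rewrite mul_triad_mx !mxE.
Qed.

Lemma same_ptP (v w : 'rV[rat]_3) :
  same_pt v w <-> exists2 c : rat, c != 0 & v = c *: w.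
Proof.
split=> [/andP[/sub_rVP[c ->] /sub_rVP[d e]]|[c c0 ->]]; last first.
  by rewrite /same_pt; apply/eqmxP; exact: eqmx_scale.
have [c0|c0] := eqVneq c 0; last by exists c.
by exists 1; rewrite ?oner_eq0 // e c0 !scale0r !scaler0.
Qed.

(** The collineation N (N')^-1. *)
Definition triad_map (V V' : triad) : 'M[rat]_3 :=
  triad_mx V *m invmx (triad_mx V').

(** The collineation is characterised by preserving the three linear forms
    themselves, and not only their zeros. *)
Lemma triad_mapP (V V' : triad) (v w : 'rV[rat]_3) :
    quot_mx V' \in unitmx ->
  w = v *m triad_map V V' <->
  [/\ incid w (tI V') = incid v (tI V), incid w (tJ V') = incid v (tJ V) &
      incid w (tK V') = incid v (tK V)].
Proof.
move=> V'u; have N'u := triad_mx_unit V'u.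
split=> [e|[eI eJ eK]]; last first.
  apply: (can_inj (mulmxK N'u)); rewrite /triad_map mulmxA mulmxKV //.
  by rewrite !mul_triad_mx eI eJ eK.
have {e} := congr1 (mulmx^~ (triad_mx V')) e.
rewrite /triad_map mulmxA mulmxKV // !mul_triad_mx => e.
by split; [have := congr1 (fun u : 'rV_3 => u 0 0) e
          |have := congr1 (fun u : 'rV_3 => u 0 1) e
          |have := congr1 (fun u : 'rV_3 => u 0 ord_max) e]; rewrite !mxE.
Qed.

Lemma incidDZ (v w : 'rV[rat]_3) (a b : rat) (L : affine) :
  incid (a *: v + b *: w) L = a * incid v L + b * incid w L.
Proof. by rewrite !incidE !mxE; ring. Qed.

Lemma incidZ (v : 'rV[rat]_3) (a : rat) (L : affine) :
  incid (a *: v) L = a * incid v L.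
Proof. by rewrite !incidE !mxE; ring. Qed.

Lemma triad_map_collineation (V V' : triad) :
    quot_mx V \in unitmx -> quot_mx V' \in unitmx ->
  triad_collineation V V' (triad_map V V').
Proof.
move=> Vu V'u; have im v := (triad_mapP V v _ V'u).1 erefl.
have maps L L' : (forall v, incid (v *m triad_map V V') L' = incid v L) ->
    maps_line (triad_map V V') (line_of L) (line_of L').
  move=> e v _; rewrite /on; split=> /incid0 h; apply/incid0; move: h.
    by rewrite -!/(incid _ _) e.
  by rewrite -!/(incid _ _) e.
split.
- by rewrite /collineation unitmx_mul unitmx_inv !triad_mx_unit.
- by apply: maps => v; case: (im v).
- by apply: maps => v; case: (im v).
- by apply: maps => v; case: (im v).
apply/same_ptP; exists 1; rewrite ?oner_eq0 // scale1r; apply/esym.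
by apply/triad_mapP; rewrite // !incid_o_infty.
Qed.

(** Every vector v becomes a vector of a given line after adding a multiple of
    the point at infinity, on which all the linear forms take the value -1.
    So each linear form is multiplied by the eigenvalue d of the point at
    infinity, the same for the three lines. *)
Lemma triad_collineation_unique (V V' : triad) (L : 'M[rat]_3)
    (v : 'rV[rat]_3) :
    quot_mx V' \in unitmx -> triad_collineation V V' L ->
  same_pt (v *m L) (v *m triad_map V V').
Proof.
move=> V'u [_ mI mJ mK /same_ptP [d d0 oL]].
have scaled l l' : maps_line L (line_of l) (line_of l') ->
    incid (v *m L) l' = d * incid v l.
  move=> ml; pose u := v + incid v l *: o_infty.
  have ul : incid u l = 0.
    rewrite /u -[X in incid (X + _)]scale1r incidDZ incid_o_infty.
    by rewrite mulrN1 mul1r subrr.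
  have : incid (u *m L) l' = 0.
    have [->|u0] := eqVneq u 0; first by rewrite mul0mx /incid mul0mx mxE.
    by apply/incid0; apply/(ml u u0); exact/incid0.
  rewrite /u mulmxDl -scalemxAl oL -[X in incid (X + _)]scale1r incidDZ incidZ.
  by rewrite incid_o_infty mulrN1 mul1r mulrN mulrC => /subr0_eq.
have e : d^-1 *: (v *m L) = v *m triad_map V V'.
  by apply/triad_mapP => //; rewrite !incidZ !(scaled _ _ mI, scaled _ _ mJ,
    scaled _ _ mK) !mulKf.
by apply/same_ptP; exists d; rewrite // -e scalerA divff // scale1r.
Qed.

(** The forms of the point (x, y) are I(x) - y and its analogues; by the
    matching equations those of the image are multiplied by a. *)
Lemma triad_map_induces (V V' : triad) :
    quot_mx V \in unitmx -> quot_mx V' \in unitmx ->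
  induces (triad_map V V') (triad_transf V V').
Proof.
move=> Vu V'u x y m a b t.
have [ad _ _] := (transf_atE _ _ _ _ Vu V'u).1 t.
have [eI eJ eK] := (transf_atP _ _ _ _ Vu V'u).1 t.
have a0 : a != 0 by apply: contra_eq_neq ad => ->; rewrite mul0r eq_sym oner_eq0.
apply/same_ptP; exists a^-1; first by rewrite invr_eq0.
apply/esym/triad_mapP => //; rewrite !incidZ !incid_pt -eI -eJ -eK.
by split; field.
Qed.

(** A homology is a scalar matrix plus a matrix of rank at most one: on the
    axis, a space consisting of eigenvectors, it acts by a single scalar s, and
    the quotient by the axis is spanned by the centre. *)
Lemma homology_form (L : 'M[rat]_3) : homology L ->
  exists (s : rat) (w : 'cV[rat]_3) (c : 'rV[rat]_3),
    forall v : 'rV[rat]_3, v *m L = s *: v + (v *m w) 0 0 *: c.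
Proof.
case=> _ [w [c [w0 c0 cw /same_ptP [t t0 cL] fix_]]].
have eig (v : 'rV[rat]_3) : v *m w = 0 -> exists k, v *m L = k *: v.
  move=> vw; have [->|v0] := eqVneq v 0.
    by exists 0; rewrite mul0mx scaler0.
  by have /same_ptP [k _ ->] := fix_ v v0 vw; exists k.
have [s sP] : exists s, forall v : 'rV[rat]_3, v *m w = 0 -> v *m L = s *: v.
  (* Any scalar does when no nonzero vector lies on the axis. *)
  have [[v1 [v1w v10]]|no] :=
      pselect (exists v1 : 'rV[rat]_3, v1 *m w = 0 /\ v1 != 0);
      last first.
    exists 0 => v vw; have [->|v0] := eqVneq v 0.
      by rewrite mul0mx scaler0.
    by case: no; exists v.
  have [s v1L] := eig v1 v1w; exists s => v vw.
  have [k vL] := eig v vw.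
  (* The eigenvalues of v, v1 and v + v1 agree unless v is a multiple of v1. *)
  have [l] : exists l, (v + v1) *m L = l *: (v + v1).
    by apply: eig; rewrite mulmxDl vw v1w addr0.
  rewrite mulmxDl vL v1L => e.
  have {}e : (k - l) *: v = (l - s) *: v1.
    rewrite !scalerBl -[k *: v](addrK (s *: v1)) e scalerDr addrAC.
    by rewrite [l *: v + _]addrC addrK.
  have [kl|kl] := eqVneq k l.
    move: e; rewrite kl subrr scale0r => /esym/eqP.
    by rewrite scaler_eq0 (negPf v10) orbF subr_eq0 => /eqP <-.
  rewrite -vL; have -> : v = ((k - l)^-1 * (l - s)) *: v1.
    by rewrite -scalerA -e scalerA mulVf ?subr_eq0 // scale1r.
  by rewrite -scalemxAl v1L !scalerA mulrC.
have cw0 : (c *m w) 0 0 != 0 by apply/eqP => /incid0.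
exists s, w, (((t - s) / (c *m w) 0 0) *: c) => v.
pose q := (v *m w) 0 0 / (c *m w) 0 0; pose v0 := v - q *: c.
have v0w : v0 *m w = 0.
  apply/incid0; rewrite mulmxBl -scalemxAl mxE.
  by rewrite [in X in _ + X]mxE [in X in _ + X]mxE divfK // subrr.
have vE : v = v0 + q *: c by rewrite subrK.
rewrite [in LHS]vE mulmxDl sP // -scalemxAl cL /v0 scalerBr !scalerA.
rewrite -addrA -scaleNr -scalerDl; congr (_ + _ *: c).
by rewrite /q; field.
Qed.

(** The X-point P and the point at infinity are eigenvectors for the distinct
    eigenvalues r < 0 and 1, so in the form v |-> s v + w(v) c of a homology,
    s is 1 or r.  If s = 1, then c is proportional to P, which lies on I' and
    J', so I and I' are equal as linear forms, and so are J and J'.  If s = r,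
    then c is proportional to the point at infinity, and the slopes satisfy
    slope(I) - slope(J) = r (slope(I') - slope(J')), against their signs. *)
Lemma triad_map_homology (p : rat) (V V' : triad) : opposed p V V' ->
  homology (triad_map V V') <-> regular V V'.
Proof.
move=> o; have [JI I'I J'I' kk ss] := o.
have [Vu V'u] := (opposed_unit o, opposed_unit (opposed_sym o)).
set L := triad_map V V'.
pose P := pt p (aeval (tI V) p).
set k := aeval (tK V) p - _ in kk; set k' := aeval (tK V') p - _ in kk.
have k0 : k != 0 by apply: contraTneq kk => ->; rewrite mul0r ltxx.
have k'0 : k' != 0 by apply: contraTneq kk => ->; rewrite mulr0 ltxx.
have PI : incid P (tI V) = 0 by rewrite incid_pt subrr.
have PJ : incid P (tJ V) = 0 by rewrite incid_pt JI subrr.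
have PK : incid P (tK V) = k by rewrite incid_pt.
have PI' : incid P (tI V') = 0 by rewrite incid_pt I'I subrr.
have PJ' : incid P (tJ V') = 0 by rewrite incid_pt J'I' I'I subrr.
have PK' : incid P (tK V') = k' by rewrite incid_pt -I'I.
have PL : P *m L = (k / k') *: P.
  apply/esym/triad_mapP => //; rewrite !incidZ PI PJ PK PI' PJ' PK'.
  by rewrite !mulr0 divfK.
have im v := (triad_mapP V v _ V'u).1 (erefl (v *m L)).
have oL : o_infty *m L = o_infty.
  by apply/esym/triad_mapP => //; rewrite !incid_o_infty.
have P2 : P 0 ord_max = 1 by rewrite mxE.
have P0 : P != 0 by apply: contra_eq_neq P2 => ->; rewrite mxE eq_sym oner_eq0.
have r_neg : k / k' < 0.
  rewrite -(pmulr_llt0 _ (_ : 0 < k' ^+ 2)) ?exprn_even_gt0 //.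
  by rewrite expr2 mulrA divfK.
split=> [/homology_form [s [w [c Lv]]]|[eI eJ]].
- have : o_infty = s *: o_infty + (o_infty *m w) 0 0 *: c by rewrite -Lv oL.
  have : (k / k') *: P = s *: P + (P *m w) 0 0 *: c by rewrite -Lv PL.
  move: (k / k') r_neg ((P *m w) 0 0) ((o_infty *m w) 0 0) => r r_neg b a eP eo.
  have {}eP : b *: c = (r - s) *: P by rewrite scalerBl eP addrC addKr.
  have {}eo : a *: c = (1 - s) *: o_infty.
    by rewrite scalerBl scale1r [X in X - _]eo addrC addKr.
  have [s1|s1] := eqVneq s 1.
  + have b0 : b != 0.
      apply: contraTneq r_neg => b0; move/eqP: eP.
      rewrite b0 scale0r eq_sym scaler_eq0 (negPf P0) orbF subr_eq0 s1.
      by move=> /eqP ->; rewrite ltr10.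
    have cP : c = (b^-1 * (r - s)) *: P.
      by rewrite -scalerA -eP scalerA mulVf // scale1r.
    have same l l' : incid P l' = 0 ->
        (forall v, incid (v *m L) l' = incid v l) ->
        l = l'.
      move=> Pl' e.
      have {}e v : incid v l' = incid v l.
        by rewrite -e Lv s1 cP scalerA incidDZ Pl' mulr0 addr0 mul1r.
      have := e (row3 1 0 0); have := e (row3 0 0 1).
      rewrite !incidE !mxE /=.
      by case: l {e} => ? ?; case: l' {Pl'} => ? ? /= ? ?; congr Affine; lra.
    split; [apply: (same _ _ PI') => v|apply: (same _ _ PJ') => v];
      by case: (im v).
  + have a0 : a != 0.
      apply: contraNneq s1 => a0; have := congr1 (fun u : 'rV_3 => u 0 1) eo.
      by rewrite a0 !mxE /= mul0r mulr1 => /esym/subr0_eq ->.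
    have co : c = (a^-1 * (1 - s)) *: o_infty.
      by rewrite -scalerA -eo scalerA mulVf // scale1r.
    have sr : r = s.
      apply: subr0_eq; have := congr1 (fun u : 'rV_3 => u 0 ord_max) eP.
      by rewrite co !mxE /= !mulr0 mulr1.
    have [eI eJ _] := im (row3 1 0 0).
    have : slope (tI V) - slope (tJ V) = r * (slope (tI V') - slope (tJ V')).
      move: eI eJ; rewrite Lv co scalerA !incidDZ !incid_o_infty.
      rewrite !incidE !mxE /= sr => ? ?.
      by lra.
    by move=> e; move: ss; rewrite e -mulrA -expr2 nmulr_rgt0 // ltNge sqr_ge0.
- split; first by case: (triad_map_collineation Vu V'u).
  have ax v : (v *m (line_of (tK V) - line_of (tK V'))) 0 0
      = incid v (tK V) - incid v (tK V').
    by rewrite mulmxBr mxE [in X in _ + X]mxE.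
  have kk0 : k - k' != 0.
    by apply: contraTneq kk => /subr0_eq ->; rewrite -expr2 -leNgt sqr_ge0.
  have Pax : ~ on P (line_of (tK V) - line_of (tK V')).
    by move=> /incid0; rewrite ax PK PK'; exact/eqP.
  exists (line_of (tK V) - line_of (tK V')), P; split=> //.
  + by apply/eqP => ax0; apply: Pax; rewrite ax0 /on mulmx0.
  + by apply/same_ptP; exists (k / k'); rewrite // mulf_neq0 // invr_eq0.
  + move=> v v0 /incid0; rewrite ax => /subr0_eq vK.
    apply/same_ptP; exists 1; rewrite ?oner_eq0 // scale1r.
    by apply/esym/triad_mapP => //; rewrite vK eI eJ.
Qed.

Theorem theorem6 (R : realFieldType) (p : rat) (W W' : triad)
    (hW : pseudotriad R p W W') :
  let T := triad_transf W W' in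
  let T' := triad_transf W' W in
  let right := (ratr p : R)^'+ in
  let left := (ratr p : R)^'- in
  (exists L : 'M[rat]_3,
     [/\ triad_collineation W W' L,
         forall L' : 'M[rat]_3, triad_collineation W W' L' ->
           forall v : 'rV[rat]_3, v != 0 -> same_pt (v *m L') (v *m L),
         homology L <-> regular W W' &
         induces L T]) /\
  [/\ quot_mx W \in unitmx,
      quot_mx W' \in unitmx,
      local_self_equiv right p W W' T,
      matches_components right (fun m : R => m < ratr p) W W' T &
      ~ trivial_transf T] /\
  [/\ inverse_transf R T T',
      local_self_equiv left p W W' T' &
      matches_components left (fun m : R => ratr p < m) W' W T'] /\
  (forall S : transf, ~ trivial_transf S ->
     (local_self_equiv right p W W' S -> same_transf S T) /\
     (local_self_equiv left p W W' S -> same_transf S T')).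
Proof.
move=> T T' right left; rewrite {}/right {}/left.
have [ho _ _] := pseudotriad_signs hW; have o' := opposed_sym ho.
have [Wu W'u] := (opposed_unit ho, opposed_unit o').
have sep := pseudotriad_separated hW.
have [rF _] := one_sided_right R p W W'.
have [lF _] := one_sided_left R p W W'.
have rP : Filter (ratr p : R)^'+ by exact: filter_filter.
have lP : Filter (ratr p : R)^'- by exact: filter_filter.
have rN := opposed_near_side (FF := rP) ho rF.
have lN := opposed_near_side (FF := lP) o' lF.
split; [|split; [|split]].
- exists (triad_map W W'); split.
  + exact: triad_map_collineation.
  + by move=> L' tL' v _; exact: triad_collineation_unique.
  + exact: triad_map_homology ho.
  + exact: triad_map_induces.
- split=> //.
  + exact: self_equiv_exists ho (one_sided_right R p W W').
  + near=> x; have px : ratr p < x by near: x; exact: nbhs_right_gt.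
    have [m [a [b [t [eI eJ eK] opp]]]] : exists m a b : R,
      [/\ transf_at T x m a b,
          matching W W' x m a b & (m - ratr p) * (x - ratr p) < 0]
      by near: x.
    exists m, a, b; split=> //.
    by move: opp; rewrite pmulr_llt0 ?subr_gt0 // subr_lt0.
  + move=> [Tid _ _].
    have rPP := at_right_proper_filter (ratr p : R).
    case: (@filter_ex _ _ rPP _ rN) => x [m [a [b [[tm _ _] _]]]].
    have xx : ratval (mobius (tmu T)) x x.
      rewrite Tid; apply/ratval_mobius; first exact: unitmx1.
      rewrite /mob_den /mob_num !mxE /= rmorph0 rmorph1.
      split; first by rewrite mul0r add0r oner_eq0.
      by rewrite mul0r add0r mul1r addr0 mulr1.
    by rewrite (ratval_uniq tm xx) -expr2 ltNge sqr_ge0.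
- split.
  + exact: triad_transf_inverse.
  + exact: self_equiv_exists o' (one_sided_left R p W W').
  + near=> x; have px : x < ratr p by near: x; exact: nbhs_left_lt.
    have [m [a [b [t [eI eJ eK] opp]]]] : exists m a b : R,
      [/\ transf_at T' x m a b,
          matching W' W x m a b & (m - ratr p) * (x - ratr p) < 0]
      by near: x.
    exists m, a, b; split=> //.
    by move: opp; rewrite nmulr_llt0 ?subr_lt0 // subr_gt0.
- move=> S Snt; split.
  + exact: self_equiv_unique ho (one_sided_right R p W W') sep Snt.
  + exact: self_equiv_unique o' (one_sided_left R p W W') sep Snt.
Unshelve. all: by end_near. Qed.
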